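(* Fix any $\alpha\in(0,1)$. There exists a constant $\beta\in(0,1)$ such that for every $n\in\mathbb{N}$ the following holds. For every integer $0\le k\le n^{\beta}$ there exists a property $\Pi_k\subseteq\Sigma_n^{N}$, where $\Sigma_n=\{0,\dots,n-1\}$ and $N=n^{1+\alpha}$ (rounded), such that for any constant $\varepsilon\in(0,1]$: (i) there exists a $(k,\tilde O(k))$-round-adaptive tester for $\Pi_k$ with one-sided error; yet (ii) any $(k,q)$-tail-adaptive (two-sided error) tester for $\Pi_k$ must satisfy $q=\Omega(n)$.
   Context: Relative Hamming distance from $\Pi$ and $\varepsilon$-far are as usual. A $(k,q)$-round-adaptive tester: given proximity parameter $\varepsilon$ and query access to $w\in\Sigma^N$, proceeds in $k+1$ rounds, in round $\ell\ge0$ choosing a set $Q_\ell$ of coordinates based on its randomness and answers to earlier rounds and receiving $w$ on $Q_\ell$, with $\sum_\ell|Q_\ell|=q$; accepts $w\in\Pi$ w.p. $\ge2/3$ and rejects $\varepsilon$-far $w$ w.p. $\ge2/3$; one-sided means members of $\Pi$ are always accepted. A $(k,q)$-tail-adaptive tester: given proximity parameter $\varepsilon$, error parameter $\delta\in(0,1]$, and query access to $w$, first queries a set $Q$ chosen using only its internal randomness, and then, over the next $k$ rounds, makes $k$ single adaptive queries $x^{(1)},\dots,x^{(k)}$ (each depending on all previous answers), with $q=|Q|+k$; it accepts $w\in\Pi$ with probability $\ge1-\delta$ and rejects $\varepsilon$-far $w$ with probability $\ge1-\delta$. The implicit constants in $\tilde O,\Omega$ may depend on $\alpha,\varepsilon$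 but not on $n,k$.
   Formalization: The Õ(k) query bound in (i) is claimed only for k ≥ 1; (ii) is claimed only for ε < 1, error δ < 1/2 and n ≥ 2, with the constant in Ω(n) also depending on δ; at k = 0, ε = 1 or δ ≥ 1/2 the statement is false as written. *)

(* Defs.v *)
From mathcomp Require Import all_boot all_order all_algebra.
From mathcomp Require Import reals exp.

Set Implicit Arguments.
Unset Strict Implicit.
Unset Printing Implicit Defensive.

Import Order.TTheory GRing.Theory Num.Theory.
Local Open Scope ring_scope.

(* Words of length N over the alphabet {0, ..., n-1}. *)
Definition word (N n : nat) := {ffun 'I_N -> 'I_n}.

(* n^(1+alpha) rounded to the nearest integer. *)
Definition wlen (R : realType) (alpha : R) (n : nat) : nat :=
  Num.truncn (n%:R `^ (1 + alpha) + 2^-1 : R).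

Section Testers.
Variable R : realType.
Variables N n : nat.
Implicit Types (v w : word N n) (Pi : {set word N n}).

Definition rel_dist w v : R := #|[set i | w i != v i]|%:R / N%:R.

Definition close eps w Pi := exists2 v, v \in Pi & rel_dist w v <= eps.
Definition far eps w Pi := ~ close eps w Pi.

(* The answers to one round of queries: the restriction of w to Q. *)
Definition view := {ffun 'I_N -> option 'I_n}.
Definition answers w (Q : {set 'I_N}) : view :=
  [ffun i => if i \in Q then Some (w i) else None].

(* A deterministic strategy. A history lists the answers of the rounds
   played so far, oldest first; its length is the index of the next round. *)
Record strategy := Strategy {
  query : seq view -> {set 'I_N};
  decide : seq view -> bool }.

Fixpoint history (A : strategy) w (l : nat) : seq view :=
  if l is l'.+1 then
    let h := history A w l' in rcons h (answers w (query A h))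
  else [::].

Definition round_query A w l : {set 'I_N} := query A (history A w l).

(* Rounds are numbered 0, ..., k. *)
Definition accepts k A w : bool := decide A (history A w k.+1).

(* A randomized strategy. There are only finitely many strategies up to their
   behaviour in k+1 rounds, so finite coin spaces with arbitrary real weights
   realize every probability distribution on behaviours. *)
Record tester := Tester {
  coins : finType;
  weight : coins -> R;
  weight_ge0 : forall o, 0 <= weight o;
  weight_sum1 : \sum_o weight o = 1;
  run : coins -> strategy }.

Definition pr (T : tester) (E : pred (coins T)) : R := \sum_(o | E o) weight o.

Definition accept_pr k (T : tester) w := pr [pred o : coins T | accepts k (run o) w].
Definition reject_pr k (T : tester) w :=
  pr [pred o : coins T | ~~ accepts k (run o) w].

Definition query_complexity k q (T : tester) :=
  forall (o : coins T) w, (\sum_(l < k.+1) #|round_query (run o) w l|)%N = q.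

Definition errs_at_most k (delta eps : R) Pi (T : tester) :=
  (forall w, w \in Pi -> 1 - delta <= accept_pr k T w) /\
  (forall w, far eps w Pi -> 1 - delta <= reject_pr k T w).

Definition round_adaptive_tester k q eps Pi (T : tester) :=
  query_complexity k q T /\ errs_at_most k (1 / 3) eps Pi T.

Definition one_sided k Pi (T : tester) :=
  forall w, w \in Pi -> accept_pr k T w = 1.

(* Round 0 is the non-adaptive set Q; rounds 1, ..., k are single queries,
   so that q = #|Q| + k. *)
Definition tail_adaptive_tester k q eps delta Pi (T : tester) :=
  [/\ query_complexity k q T,
      (forall (o : coins T) w l, (0 < l <= k)%N -> #|round_query (run o) w l| = 1%N)
    & errs_at_most k delta eps Pi T].

End Testers.

(* Main.v *)
(* A word consists of hidden keys s_j, one for each of L columns, and of B * L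
   cells arranged in L columns of height B.  Block b collects the cell of height
   b + s_j (mod B) of every column j, and the property requires every block to be
   a Reed-Solomon codeword of dimension d = k + O(1), with B about
   n^(1 + alpha/2), L about n^(alpha/2) and k <= n^(alpha/4).
   One adaptive round suffices for testing: read the keys of the first d columns
   and of a random one, then the corresponding cells of a random block, and check
   that they extend to a codeword.
   For the lower bound draw the keys at random.  A fixed set of fewer than n
   queries meets every block in O(1) cells with high probability, because the
   cells outnumber it by n^alpha, and the k single tail queries add at most k
   more.  So at most d cells of each block are seen, and random codewords look
   exactly like random contents, which are far from the property by counting. *)

Require Import Defs.
From mathcomp Require Import all_boot all_order all_algebra finfield.
From mathcomp Require Import reals exp zify ring lra.

Set Implicit Arguments.
Unset Strict Implicit.
Unset Printing Implicit Defensive.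

Import Order.TTheory GRing.Theory Num.Theory.
Local Open Scope ring_scope.

(** * Subcubes, fibrewise counts and padding of sets *)

Lemma card_agree (T S : finType) (D : {set T}) (x : {ffun T -> S}) :
  #|[set X : {ffun T -> S} | [forall c in D, X c == x c]]| = (#|S| ^ #|~: D|)%N.
Proof.
pose P c := if c \in D then pred1 (x c) else predT.
rewrite cardsE (eq_card (B := family P)); last first.
  move=> X; rewrite inE; apply/forall_inP/familyP => [XD c|XP c cD].
    by rewrite /P; case: ifP => // cD; rewrite !inE XD.
  by have := XP c; rewrite /P cD !inE.
rewrite card_family foldrE big_image /=.
rewrite (bigID (mem D)) /= big1 => [|c cD]; last by rewrite /P cD card1.
rewrite mul1n (eq_bigr (fun=> #|S|)) => [|c cD]; last by rewrite /P (negPf cD) cardT.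
by rewrite prod_nat_const; congr (_ ^ _)%N; apply: eq_card => c; rewrite !inE.
Qed.

Lemma card_fiberwise (Y J : finType) (D : {set Y * J}) d :
  (forall y, #|[set j | (y, j) \in D]| = d) -> #|D| = (#|Y| * d)%N.
Proof.
move=> Dd; rewrite -sum1_card (partition_big fst predT) //=.
rewrite (eq_bigr (fun=> d)) ?sum_nat_const // => y _.
rewrite -[RHS](Dd y) -sum1_card (reindex_onto (fun j => (y, j)) snd) /=.
  by apply: eq_bigl => j; rewrite inE !eqxx !andbT.
by case=> y' j /= /andP[_ /eqP ->].
Qed.

(** A canonical enlargement towards size [t], used both to make query counts exact and to give all
    subcubes the same size. It depends on [S] and [t] alone, so equal query sets are padded
    equally. *)
Definition pad (T : finType) (S : {set T}) (t : nat) : {set T} :=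
  S :|: [set x in take (t - #|S|) (enum (~: S))].

Lemma sub_pad (T : finType) (S : {set T}) t : S \subset pad S t.
Proof. exact: subsetUl. Qed.

Lemma card_pad (T : finType) (S : {set T}) t :
  (#|S| <= t)%N -> #|pad S t| = minn t #|T|.
Proof.
move=> St; rewrite cardsU disjoint_setI0 ?cards0 ?subn0; last first.
  rewrite disjoint_sym disjoint_subset; apply/subsetP => x; rewrite !inE.
  by move/mem_take; rewrite mem_enum inE.
rewrite cardsE (card_uniqP _) ?take_uniq ?enum_uniq // size_take_min -cardE.
by have := cardsC S; lia.
Qed.

(** * Reed-Solomon codewords *)

Section Code.
Variables (F : finFieldType) (L d : nat) (pt : 'I_L -> F).

Definition rs (u : {ffun 'I_d -> F}) (j : 'I_L) : F := \sum_i u i * pt j ^+ i.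

(** A nonzero polynomial of size at most [d] has fewer than [d] roots, so [d] values at distinct
    points determine the message. *)
Lemma rs_inj (J : {set 'I_L}) u v :
  injective pt -> (d <= #|J|)%N -> {in J, rs u =1 rs v} -> u = v.
Proof.
move=> pt_inj dJ uv; apply/ffunP => i; apply/eqP; rewrite -subr_eq0; apply/eqP.
pose p := \poly_(i < d) (oapp (fun i => u i - v i) 0 (insub i : option 'I_d)).
have <- : p`_i = u i - v i by rewrite coef_poly ltn_ord valK.
suff -> : p = 0 by rewrite coef0.
apply: contraTeq dJ => p0; rewrite -ltnNge.
apply: leq_trans (size_poly _ _ : (size p <= d)%N).
have -> : #|J| = size (map pt (enum J)) by rewrite size_map cardE.
apply: max_poly_roots => //; last by rewrite map_inj_uniq ?enum_uniq.
apply/allP => _ /mapP[j jJ ->]; rewrite /root horner_poly.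
under eq_bigr => l _ do rewrite valK /= mulrBl.
by rewrite sumrB subr_eq0; apply/eqP/uv; rewrite -mem_enum.
Qed.

End Code.

(** * Runs that receive the same answers *)

Section Strategies.
Variables N n : nat.
Implicit Types (A : strategy N n) (w : word N n).

Definition queried A w k : {set 'I_N} := \bigcup_(l < k.+1) round_query A w l.

(** Induction on the rounds: equal histories lead to the same next query set, on which the two words
    agree. *)
Lemma history_eq A w w' k l : (l <= k.+1)%N ->
  {in queried A w k, w =1 w'} -> history A w l = history A w' l.
Proof.
move=> + ww'; elim: l => //= l IH lk; rewrite -IH 1?ltnW //; congr rcons.
apply/ffunP => i; rewrite !ffunE; case: ifP => // iq; congr Some; apply: ww'.
by apply/bigcupP; exists (Ordinal lk).
Qed.

Lemma accepts_eq A w w' k :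
  {in queried A w k, w =1 w'} -> accepts k A w = accepts k A w'.
Proof. by move=> ww'; rewrite /accepts (history_eq (leqnn _) ww'). Qed.

Lemma queried_eq A w w' k :
  {in queried A w k, w =1 w'} -> queried A w k = queried A w' k.
Proof.
move=> ww'; apply: eq_bigr => l _.
by rewrite /round_query (history_eq (ltnW (ltn_ord l)) ww').
Qed.

End Strategies.

(** * Words with hidden keys *)

Section Encoding.
Variables (F : finFieldType) (Y : finZmodType) (L d N n : nat).
Variables (pt : 'I_L -> F) (pos : 'I_L * bool + Y * 'I_L -> 'I_N).
Variables (e : F -> 'I_n) (ek : Y -> bool -> 'I_n) (z0 : 'I_n).
Hypotheses (pt_inj : injective pt) (pos_inj : injective pos) (dL : (d <= L)%N).

Notation key := {ffun 'I_L -> Y}.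
Notation content := {ffun Y * 'I_L -> F}.
Notation message := {ffun Y -> {ffun 'I_d -> F}}.
Implicit Types (s : key) (X : content) (g : message).

Definition cellpos s b j : 'I_N := pos (inr (b + s j, j)).

(** A key takes two symbols, selected by the boolean, because in the application it ranges over more
    than [n] values. Block [b] meets column [j] at height [b + s j], hence the subtraction when a
    cell is read back. *)
Definition emb s X : word N n := [ffun i =>
  match [pick t | pos t == i] with
  | Some (inl (j, c)) => ek (s j) c
  | Some (inr z) => e (X (z.1 - s z.2, z.2))
  | None => z0
  end].

Lemma emb_key s X j c : emb s X (pos (inl (j, c))) = ek (s j) c.
Proof.
rewrite ffunE; case: pickP => [t /eqP/pos_inj -> //|/(_ (inl (j, c)))].
by rewrite eqxx.
Qed.

Lemma emb_cell s X b j : emb s X (cellpos s b j) = e (X (b, j)).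
Proof.
rewrite ffunE; case: pickP => [t /eqP/pos_inj -> /=|/(_ (inr (b + s j, j)))].
  by rewrite addrK.
by rewrite eqxx.
Qed.

Lemma emb_agree s X X' i :
  (forall b j, i = cellpos s b j -> X (b, j) = X' (b, j)) ->
  emb s X i = emb s X' i.
Proof.
move=> XX'; rewrite !ffunE; case: pickP => // -[[//]|[y j]] /eqP ti /=.
by congr e; apply: XX'; rewrite /cellpos subrK.
Qed.

Definition enc g : content := [ffun c => rs pt (g c.1) c.2].

Definition block_prop : {set word N n} := [set emb p.1 (enc p.2) | p : key * message].

(* The sets of contents agreeing with an accepted codeword on d cells of each
   block, all queried cells included, are disjoint subcubes of equal size. *)
Lemma accepts_code_le (A : strategy N n) k s :
  (forall g b,
     #|[set j | cellpos s b j \in queried A (emb s (enc g)) k]| <= d)%N ->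
  (#|[set g | accepts k A (emb s (enc g))]| * #|F| ^ (#|Y| * (L - d)) <=
   #|[set X | accepts k A (emb s X)]|)%N.
Proof.
move=> few.
pose D (Q : {set 'I_N}) : {set Y * 'I_L} :=
  [set c | c.2 \in pad [set j | cellpos s c.1 j \in Q] d].
pose Dg g := D (queried A (emb s (enc g)) k).
pose cube g := [set X : content | [forall c in Dg g, X c == enc g c]].
have Dfib g b : #|[set j | (b, j) \in Dg g]| = d.
  transitivity (minn d #|'I_L|); last by rewrite card_ord; apply/minn_idPl.
  rewrite -(card_pad (few g b)); apply: eq_card => j.
  by rewrite !inE.
have cardD g : #|~: Dg g| = (#|Y| * (L - d))%N.
  by rewrite cardsCs setCK card_prod card_ord (card_fiberwise (Dfib g)) mulnBr.
have cube_agree g X : X \in cube g ->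
    {in queried A (emb s (enc g)) k, emb s (enc g) =1 emb s X}.
  rewrite inE => /forall_inP XD i iq; apply: emb_agree => b j ij.
  apply/esym/eqP/XD; rewrite inE /= (subsetP (sub_pad _ _)) //.
  by rewrite inE /= -ij.
(* A common content [X] forces both runs to query what the run on [X] queries. The padded cell sets
   then coincide, and codewords equal on [d] cells of each block have the same message. *)
have cube_disj g g' X : X \in cube g -> X \in cube g' -> g = g'.
  move=> Xg Xg'; have DD : Dg g = Dg g'.
    by rewrite /Dg (queried_eq (cube_agree _ _ Xg)) (queried_eq (cube_agree _ _ Xg')).
  apply/ffunP => b; apply: (rs_inj (J := [set j | (b, j) \in Dg g]) pt_inj).
    by rewrite Dfib.
  move=> j; rewrite inE => bj.
  move: Xg Xg'; rewrite !inE => /forall_inP/(_ _ bj)/eqP + /forall_inP.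
  by rewrite -DD => + /(_ _ bj)/eqP => ->; rewrite !ffunE.
(* Double counting of the pairs of an accepted message and a content in its cube: such a content is
   accepted too, and lies in only one cube. *)
rewrite -sum_nat_const.
rewrite (eq_bigr (fun g => \sum_(X in cube g) 1%N)) => [|g _]; last first.
  by rewrite sum1_card card_agree cardD.
rewrite (exchange_big_dep (mem [set X | accepts k A (emb s X)])) /=; last first.
  by move=> g X; rewrite inE => ga Xc; rewrite inE -(accepts_eq (cube_agree _ _ Xc)).
rewrite -[leqRHS]sum1_card; apply: leq_sum => X _.
rewrite sum1_card; apply/card_le1_eqP => g g'.
by rewrite -!topredE /= => /andP[_ gX] /andP[_ /cube_disj]; apply.
Qed.

End Encoding.

(** * Crowded keys and words close to the property *)

Lemma leq_bin_exp m r : ('C(m, r) <= m ^ r)%N.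
Proof.
apply: leq_trans (leq_pmulr _ (fact_gt0 r)) _; rewrite bin_ffact ffact_prod.
rewrite -[r in leqRHS]card_ord -prod_nat_const.
by apply: leq_prod => i _; apply: leq_subr.
Qed.

Lemma leq_card_bigcup (I T : finType) (P : pred I) (A : I -> {set T}) :
  (#|\bigcup_(i | P i) A i| <= \sum_(i | P i) #|A i|)%N.
Proof.
elim/big_rec2: _ => [|i U m _ Um]; first by rewrite cards0.
by apply: leq_trans (leq_card_setU _ _) _; rewrite leq_add2l.
Qed.

Lemma subset_of_card (T : finType) (J : {set T}) r :
  (r <= #|J|)%N -> exists2 J' : {set T}, J' \subset J & #|J'| = r.
Proof.
rewrite -bin_gt0 -cards_draws => /card_gt0P[J']; rewrite inE => /andP[JJ /eqP Jr].
by exists J'.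
Qed.

(** There are at most [2 ^ #|T|] choices for the set of differing points. Outside it [y] and the
    injectivity of [e] determine [X]; inside it at most [m] values are free. *)
Lemma card_near (T S S' : finType) (e : S -> S') (y : T -> S') m :
  injective e -> (0 < #|S|)%N ->
  (#|[set X : {ffun T -> S} | #|[set c | e (X c) != y c]| <= m]| <=
   2 ^ #|T| * #|S| ^ m)%N.
Proof.
move=> e_inj S0; pose diff (X : {ffun T -> S}) := [set c | e (X c) != y c].
pose G D := [set X | diff X == D].
set U := [set X | _].
have UG : U \subset \bigcup_(D : {set T} | (#|D| <= m)%N) G D.
  apply/subsetP => X; rewrite inE => Xm; apply/bigcupP; exists (diff X) => //.
  by rewrite inE.
apply: leq_trans (subset_leq_card UG) _.
apply: leq_trans (leq_card_bigcup _ _) _.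
apply: (@leq_trans (\sum_(D : {set T} | (#|D| <= m)%N) #|S| ^ m)); last first.
  rewrite sum_nat_const leq_pmul2r ?expn_gt0 ?S0 // -cardsT -card_powerset.
  by rewrite subset_leq_card //; apply/subsetP => D _; rewrite inE subsetT.
apply: leq_sum => D Dm; have [->|[x xD]] := set_0Vmem (G D); first by rewrite cards0.
apply: (@leq_trans (#|S| ^ #|~: ~: D|)); last first.
  by rewrite setCK leq_pexp2l.
rewrite -(card_agree (~: D) x) subset_leq_card //; apply/subsetP => X.
rewrite !inE in xD * => /eqP XD; apply/forall_inP => c; rewrite inE => cD.
have /negbFE/eqP Xc : e (X c) != y c = false by rewrite -(negPf cD) -XD inE.
have /negbFE/eqP xc : e (x c) != y c = false.
  by rewrite -(negPf cD) -(eqP xD) inE.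
by apply/eqP/e_inj; rewrite Xc.
Qed.

Section Counting.
Variables (F : finFieldType) (Y : finZmodType) (L d N n : nat).
Variables (pt : 'I_L -> F) (pos : 'I_L * bool + Y * 'I_L -> 'I_N).
Variables (e : F -> 'I_n) (ek : Y -> bool -> 'I_n) (z0 : 'I_n).
Hypotheses (pos_inj : injective pos) (e_inj : injective e).

Notation key := {ffun 'I_L -> Y}.
Notation content := {ffun Y * 'I_L -> F}.

Definition crowded (Q : {set 'I_N}) r : {set key} :=
  [set s | [exists b, r <= #|[set j | cellpos pos s b j \in Q]|]%N].

(** A union bound over the block [b] and over [r] content cells of [Q]: that they all belong to
    block [b] fixes the keys of [r] columns. *)
Lemma card_crowded Q r :
  (#|crowded Q r| * #|Y| ^ r <= #|Y| * #|Q| ^ r * #|Y| ^ L)%N.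
Proof.
pose Qc := [set z | pos (inr z) \in Q].
pose G b (D : {set Y * 'I_L}) := [set s : key | [forall z in D, z.1 == b + s z.2]].
have QcQ : (#|Qc| <= #|Q|)%N.
  rewrite -(card_imset (f := pos \o inr) Qc) => [|z z' /pos_inj [] //].
  by rewrite subset_leq_card //; apply/subsetP => _ /imsetP[z + ->]; rewrite inE.
have cardG b (D : {set Y * 'I_L}) : #|D| = r -> (#|G b D| * #|Y| ^ r <= #|Y| ^ L)%N.
  move=> Dr; have [->|[s0 s0G]] := set_0Vmem (G b D); first by rewrite cards0.
  rewrite inE in s0G; move/forall_inP: s0G => s0G.
  (* Two cells of one column never belong to the same block, so a nonempty [G b D] gives [r]
     distinct columns. *)
  have Dcol : #|snd @: D| = r.
    rewrite card_in_imset // => -[y j] [y' j'] /s0G/eqP /= -> /s0G/eqP /= ->.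
    by move=> ->.
  have := cardsC (snd @: D); rewrite Dcol card_ord addnC => Lr.
  rewrite -[X in (_ <= _ ^ X)%N]Lr expnD leq_mul2r -(card_agree (snd @: D) s0); apply/orP; right.
  apply/subset_leq_card/subsetP => s; rewrite !inE => /forall_inP sG.
  apply/forall_inP => _ /imsetP[z zD ->].
  by apply/eqP/(addrI b); rewrite -(eqP (sG _ zD)) (eqP (s0G _ zD)).
have sub : crowded Q r \subset
    \bigcup_b \bigcup_(D in [set D : {set Y * 'I_L} | D \subset Qc & #|D| == r]) G b D.
  apply/subsetP => s; rewrite inE => /existsP[b /subset_of_card[J JQ Jr]].
  apply/bigcupP; exists b => //.
  apply/bigcupP; exists [set (b + s j, j) | j in J].
    rewrite inE card_imset ?Jr ?eqxx ?andbT; last by move=> j j' [].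
    by apply/subsetP => _ /imsetP[j /(subsetP JQ) + ->]; rewrite !inE.
  by rewrite inE; apply/forall_inP => _ /imsetP[j _ ->].
apply: (@leq_trans ((\sum_(b : Y) \sum_(D in
   [set D : {set Y * 'I_L} | D \subset Qc & #|D| == r]) #|G b D|) * #|Y| ^ r)).
  rewrite leq_mul2r; apply/orP; right; apply: leq_trans (subset_leq_card sub) _.
  apply: leq_trans (leq_card_bigcup _ _) _.
  by apply: leq_sum => b _; apply: leq_card_bigcup.
rewrite big_distrl /= -mulnA -sum_nat_const; apply: leq_sum => b _.
rewrite big_distrl /=.
apply: (@leq_trans (\sum_(D in
    [set D : {set Y * 'I_L} | D \subset Qc & #|D| == r]) #|Y| ^ L)).
  by apply: leq_sum => D; rewrite inE => /andP[_ /eqP]; apply: cardG.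
rewrite sum_nat_const leq_mul2r cards_draws; apply/orP; right.
by apply: leq_trans (leq_bin2l _ QcQ) (leq_bin_exp _ _).
Qed.

Definition near_prop m : {set key * content} :=
  [set p | [exists v in block_prop d pt pos e ek z0,
    #|[set i | emb pos e ek z0 p.1 p.2 i != v i]| <= m]%N].

(** For each key, a union over the members [v] of the contents that [card_near] counts around [v]; a
    member is given by a key and a message. *)
Lemma card_near_prop m :
  (#|near_prop m| <= #|Y| ^ L * (#|Y| ^ L * #|F| ^ (d * #|Y|) *
      (2 ^ (#|Y| * L) * #|F| ^ m)))%N.
Proof.
have F0 : (0 < #|F|)%N by apply/card_gt0P; exists 0.
have cardS : #|{: key}| = (#|Y| ^ L)%N by rewrite card_ffun card_ord.
rewrite -sum1_card (partition_big fst predT) //= -cardS -sum_nat_const.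
apply: leq_sum => s _.
pose G (v : word N n) := [set X : content |
  #|[set c | e (X c) != v (cellpos pos s c.1 c.2)]| <= m]%N.
have cardG v : (#|G v| <= 2 ^ (#|Y| * L) * #|F| ^ m)%N.
  by have := card_near (fun c => v (cellpos pos s c.1 c.2)) m e_inj F0;
    rewrite card_prod card_ord.
pose P := block_prop d pt pos e ek z0.
have cardP : (#|P| <= #|{: key}| * #|F| ^ (d * #|Y|))%N.
  apply: leq_trans (leq_imset_card _ _) _; rewrite card_prod !card_ffun !card_ord.
  by rewrite expnM.
apply: (@leq_trans #|\bigcup_(v in P) G v|); last first.
  apply: leq_trans (leq_card_bigcup _ _) _.
  apply: (@leq_trans (\sum_(v in P) 2 ^ (#|Y| * L) * #|F| ^ m)).
    by apply: leq_sum => v _; apply: cardG.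
  by rewrite sum_nat_const leq_mul2r cardP orbT.
rewrite sum1_card -(card_in_imset (f := snd)) => [|[s1 X1] [s2 X2]]; last first.
  by rewrite -!topredE /= => /andP[_ /eqP ->] /andP[_ /eqP ->] ->.
apply/subset_leq_card/subsetP => _ /imsetP[[s' X] + ->].
rewrite -!topredE /= inE => /andP[/existsP[v /andP[vP Xv]] /eqP ss].
apply/bigcupP; exists v => //; rewrite inE -ss; apply: leq_trans Xv.
rewrite -(card_imset (f := fun c => cellpos pos s' c.1 c.2)); last first.
  by move=> [b j] [b' j'] /pos_inj[] + jj; rewrite -jj => /addIr ->.
apply/subset_leq_card/subsetP => _ /imsetP[[b j] + ->].
by rewrite !inE /= emb_cell.
Qed.

End Counting.

(** * The tail-adaptive lower bound *)

Section AcceptanceProbability.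
Variables (R : realType) (N n k : nat) (T : tester R N n).

Lemma accept_prE w : accept_pr k T w = \sum_(o : coins T) weight o * (accepts k (run o) w)%:R.
Proof.
rewrite /accept_pr /pr big_mkcond; apply: eq_bigr => o _ /=.
by case: accepts; rewrite ?mulr1 ?mulr0.
Qed.

Lemma accept_reject_pr w : accept_pr k T w + reject_pr k T w = 1.
Proof.
by rewrite -(weight_sum1 T) [RHS](bigID (fun o : coins T => accepts k (run o) w)).
Qed.

Lemma reject_pr_ge0 w : 0 <= reject_pr k T w.
Proof. by apply: sumr_ge0 => o _; apply: weight_ge0. Qed.

(** Averaging over inputs before coins reduces the lower bound to deterministic strategies, as in
    Yao's principle. *)
Lemma sum_accept_pr (I : finType) (h : I -> word N n) :
  \sum_i accept_pr k T (h i) =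
  \sum_(o : coins T) weight o * #|[set i | accepts k (run o) (h i)]|%:R.
Proof.
under eq_bigr => i _ do rewrite accept_prE.
rewrite exchange_big /=; apply: eq_bigr => o _; rewrite -mulr_sumr; congr (_ * _).
by rewrite -natr_sum -sum1dep_card [in RHS]big_mkcond.
Qed.

End AcceptanceProbability.

Section LowerBound.
Variables (F : finFieldType) (Y : finZmodType) (L d N n : nat).
Variables (pt : 'I_L -> F) (pos : 'I_L * bool + Y * 'I_L -> 'I_N).
Variables (e : F -> 'I_n) (ek : Y -> bool -> 'I_n) (z0 : 'I_n).
Hypotheses (pt_inj : injective pt) (pos_inj : injective pos).
Hypotheses (e_inj : injective e) (dL : (d <= L)%N).

(** Fewer than [r] cells of the block come from round 0 and at most one from each of the [k] tail
    rounds. *)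
Lemma card_queried_block (A : strategy N n) w k r (s : {ffun 'I_L -> Y}) b :
  (k + r <= d.+1)%N -> s \notin crowded pos (round_query A w 0) r ->
  (forall l, (0 < l <= k)%N -> #|round_query A w l| = 1%N) ->
  (#|[set j | cellpos pos s b j \in queried A w k]| <= d)%N.
Proof.
move=> krd sQ one; pose B (Q : {set 'I_N}) := [set j | cellpos pos s b j \in Q].
have B1 l : (0 < l <= k)%N -> (#|B (round_query A w l)| <= 1)%N.
  move=> /one <-; rewrite -(card_imset (f := cellpos pos s b)); last first.
    by move=> j j' /pos_inj[].
  by apply/subset_leq_card/subsetP => _ /imsetP[j + ->]; rewrite inE.
have B0 : (#|B (round_query A w 0)| < r)%N.
  by move: sQ; rewrite inE negb_exists => /forallP/(_ b); rewrite -ltnNge.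
have sub : B (queried A w k) \subset
    B (round_query A w 0) :|: \bigcup_(l < k) B (round_query A w l.+1).
  apply/subsetP => j; rewrite inE /queried big_ord_recl !inE => /orP[->//|].
  move=> /bigcupP[l _ jl]; apply/orP; right; apply/bigcupP; exists l => //.
  by rewrite inE.
apply: leq_trans (subset_leq_card sub) _.
apply: leq_trans (leq_card_setU _ _) _.
rewrite -ltnS -addSn (leq_trans _ krd) // addnC leq_add //.
apply: leq_trans (leq_card_bigcup _ _) _.
apply: (@leq_trans (\sum_(l < k) 1)); last by rewrite sum1_card card_ord.
by apply: leq_sum => l _; apply: B1 => /=.
Qed.

(** Acceptance is compared on a random member and on a random content, both under a random key. It
    is at least [1 - delta] on the former and at most [delta] plus the fraction of near words on the
    latter; by [accepts_code_le] the former exceeds the latter by at most the chance of a crowded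
    key. *)
Lemma tail_adaptive_bound (R : realType) (T : tester R N n) k q r (eps delta : R) :
  (k + r <= d.+1)%N -> 0 <= delta ->
  tail_adaptive_tester k q eps delta (block_prop d pt pos e ek z0) T ->
  1 - 2 * delta <=
    (#|Y| * q ^ r)%:R / (#|Y| ^ r)%:R +
    (#|Y| ^ L * #|F| ^ (d * #|Y|) *
      (2 ^ (#|Y| * L) * #|F| ^ Num.truncn (eps * N%:R)))%:R /
      (#|F| ^ (#|Y| * L))%:R.
Proof.
move=> krd delta0 [qk one [yes no]].
set m := Num.truncn _; set f := #|F|; set y := #|Y|.
have f0 : (0 < f)%N by apply/card_gt0P; exists 0.
have y0 : (0 < y)%N by apply/card_gt0P; exists 0.
pose S := (y ^ L)%N; pose Z := (f ^ (y * L))%N; pose M := (f ^ (y * (L - d)))%N.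
have cardS : #|{: {ffun 'I_L -> Y}}| = S by rewrite card_ffun card_ord.
have cardZ : #|{: {ffun Y * 'I_L -> F}}| = Z.
  by rewrite card_ffun card_prod card_ord.
have cardm : #|{: {ffun Y -> {ffun 'I_d -> F}}}| = (f ^ (y * d))%N.
  by rewrite !card_ffun card_ord -expnM mulnC.
have MZ : (M * f ^ (y * d) = Z)%N by rewrite -expnD -mulnDr subnK.
(* Round 0 precedes all answers, so its query set can be computed on an arbitrary word. *)
pose w0 : word N n := [ffun=> z0].
pose Q (o : coins T) := round_query (run o) w0 0.
pose P := accept_pr k T.
have crowd o : (#|crowded (Y := Y) pos (Q o) r| * y ^ r <= y * q ^ r * S)%N.
  apply: leq_trans (card_crowded pos_inj _ _) _.
  rewrite leq_mul2r leq_mul2l; apply/orP; right; apply/orP; right.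
  have {qk} := qk o w0; rewrite big_ord_recl => qk.
  have : (#|Q o| <= q)%N by rewrite -qk leq_addr.
  by case: r {krd} => // r' Qq; rewrite leq_exp2r.
have lower : (S * f ^ (y * d))%:R * (1 - delta) <=
    \sum_s \sum_(g : {ffun Y -> {ffun 'I_d -> F}}) P (emb pos e ek z0 s (enc pt g)).
  rewrite -cardS -cardm -card_prod pair_big /= mulr_natl -sumr_const.
  by apply: ler_sum => p _; apply/yes/imset_f.
have upper : \sum_s \sum_X P (emb pos e ek z0 s X) <=
    (S * Z)%:R * delta + #|near_prop d pt pos e ek z0 m|%:R.
  rewrite -cardS -cardZ -card_prod pair_big /= mulr_natl -!sumr_const.
  rewrite [X in _ <= _ + X]big_mkcond -big_split /=.
  apply: ler_sum => -[s X] _; have PR := accept_reject_pr k T (emb pos e ek z0 s X).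
  have := reject_pr_ge0 k T (emb pos e ek z0 s X).
  case: ifP => [_ R0|far_p _]; first by rewrite /P /=; lra.
  suff : 1 - delta <= reject_pr k T (emb pos e ek z0 s X) by rewrite /P /=; lra.
  apply: no => -[v vP close]; move/negP: far_p; apply.
  rewrite inE; apply/existsP; exists v; rewrite vP /=.
  have [N0|N0] := posnP N; first by rewrite (leq_trans (max_card _)) // card_ord N0.
  have close' := close; rewrite /rel_dist ler_pdivrMr ?ltr0n // in close'.
  by rewrite truncn_ge_nat // (le_trans (ler0n R _) close').
(* The factor [M], the number of contents per message, brings the two sums to the same scale. A
   crowded key costs at most [Z]. *)
have step : (\sum_s \sum_(g : {ffun Y -> {ffun 'I_d -> F}})
      P (emb pos e ek z0 s (enc pt g))) * M%:R <=
    \sum_s \sum_X P (emb pos e ek z0 s X) +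
      \sum_o weight o * (#|crowded (Y := Y) pos (Q o) r| * Z)%:R.
  rewrite mulr_suml.
  have -> : \sum_o weight o * (#|crowded (Y := Y) pos (Q o) r| * Z)%:R =
      \sum_s \sum_o weight o * ((s \in crowded (Y := Y) pos (Q o) r) * Z)%:R.
    rewrite exchange_big; apply: eq_bigr => o _; rewrite -mulr_sumr; congr (_ * _).
    by rewrite -natr_sum -big_distrl /= -sum1_card [in LHS]big_mkcond.
  rewrite -big_split /=; apply: ler_sum => s _.
  rewrite !sum_accept_pr mulr_suml -big_split /=; apply: ler_sum => o _.
  rewrite -mulrA -mulrDr ler_wpM2l ?weight_ge0 // -natrM -natrD ler_nat.
  have [_|sQ] := boolP (s \in _).
    rewrite mul1n -MZ mulnC -cardm (leq_trans _ (leq_addl _ _)) //.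
    by rewrite leq_mul2l max_card orbT.
  rewrite mul0n addn0; apply: accepts_code_le => // g b.
  by apply: card_queried_block krd _ _ => // l /one.
have total : \sum_o weight o * (#|crowded (Y := Y) pos (Q o) r| * Z)%:R <=
    (y * q ^ r)%:R / (y ^ r)%:R * (S * Z)%:R.
  rewrite -[leRHS]mul1r -[X in X * _](weight_sum1 T) mulr_suml; apply: ler_sum => o _.
  rewrite ler_wpM2l ?weight_ge0 // natrM mulrAC ler_pdivlMr ?ltr0n ?expn_gt0 ?y0 //.
  by rewrite -!natrM ler_nat mulnAC mulnA leq_mul2r crowd orbT.
have := card_near_prop d pt (Y := Y) ek z0 pos_inj e_inj m.
rewrite -(ler_nat R) => near.
have SZ0 : 0 < (S * Z)%:R :> R by rewrite ltr0n muln_gt0 !expn_gt0 y0 f0.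
rewrite -(ler_pM2r SZ0) [leRHS]mulrDl -[(f ^ (y * L))%N]/Z.
have -> : forall x : R, x / Z%:R * (S * Z)%:R = S%:R * x.
  by move=> x; rewrite natrM; field; rewrite pnatr_eq0 -lt0n expn_gt0 f0.
rewrite -natrM.
have Mlow := ler_wpM2r (ler0n R M) lower.
have SZM : (S * f ^ (y * d))%:R * (1 - delta) * M%:R = (S * Z)%:R * (1 - delta) :> R.
  by rewrite mulrAC -natrM -mulnA (mulnC _ M) MZ.
rewrite SZM in Mlow.
move: Mlow step upper total near; rewrite -/S -/f -/y.
lra.
Qed.
End LowerBound.

(** * Testers *)

Lemma history_consE N n (A : strategy N n) w l : exists h,
  history A w l.+1 = answers w (query A [::]) :: h /\ size h = l.
Proof.
elim: l => [|l [h [E sh]]]; first by exists [::].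
exists (rcons h (answers w (query A (history A w l.+1)))).
by rewrite size_rcons sh -rcons_cons -E.
Qed.

Lemma history_cons2E N n (A : strategy N n) w l : exists h,
  history A w l.+2 = [:: answers w (query A [::]),
    answers w (query A [:: answers w (query A [::])]) & h] /\ size h = l.
Proof.
elim: l => [|l [h [E sh]]]; first by exists [::].
exists (rcons h (answers w (query A (history A w l.+2)))).
by rewrite size_rcons sh -!rcons_cons -E.
Qed.

(** Without queries, acceptance has the same probability on [v] and on [w], but it must be at least
    [1 - delta] on one and at most [delta] on the other. *)
Lemma tail_adaptive_query_gt0 (R : realType) N n (T : tester R N n)
    (Pi : {set word N n}) k q (eps delta : R) v w :
  delta < 1 / 2 -> v \in Pi -> far eps w Pi ->
  tail_adaptive_tester k q eps delta Pi T -> (0 < q)%N.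
Proof.
move=> delta2 vPi wfar [qk _ [/(_ v vPi) yes /(_ w wfar) no]].
rewrite lt0n; apply/eqP => q0; move: yes no.
suff -> : accept_pr k T v = accept_pr k T w.
  by have := accept_reject_pr k T w; lra.
apply: eq_bigl => o /=; apply: accepts_eq => i /bigcupP[l _].
suff -> : round_query (run o) v l = set0 by rewrite inE.
apply/eqP; rewrite -cards_eq0 -leqn0 -[leqRHS]q0 -(qk o v).
by rewrite (bigD1 l) //= leq_addr.
Qed.

Section Deterministic.
Variables (R : realType) (N n : nat) (A : strategy N n).

Definition det_tester : tester R N n.
Proof.
apply: (@Tester R N n unit (fun=> 1) _ _ (fun=> A)) => [//|].
by rewrite sumr_const card_unit.
Defined.

Lemma det_accept_pr k w : accept_pr k det_tester w = (accepts k A w)%:R.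
Proof. by rewrite accept_prE /= (big_pred1 tt) ?mul1r // => -[]. Qed.

End Deterministic.

Section ReadAll.
Variables (N n : nat) (Pi : {set word N n}).

Definition read_all : strategy N n := Strategy
  (fun h => if h is [::] then setT else set0)
  (fun h => if h is v :: _ then [exists w in Pi, v == answers w setT] else false).

Lemma read_all_accepts k w : accepts k read_all w = (w \in Pi).
Proof.
rewrite /accepts; have [h [-> _]] := history_consE read_all w k.
apply/existsP/idP => /= [[v /andP[vPi /eqP/ffunP wv]]|wPi]; last first.
  by exists w; rewrite wPi eqxx.
suff -> : w = v by [].
by apply/ffunP => i; have := wv i; rewrite !ffunE inE => -[].
Qed.

Lemma read_all_queries k w : (\sum_(l < k.+1) #|round_query read_all w l|)%N = N.
Proof.
rewrite big_ord_recl big1 => [|l _]; first by rewrite addn0 cardsT card_ord.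
rewrite /round_query lift0; have [h [-> _]] := history_consE read_all w l.
by rewrite /= cards0.
Qed.

Lemma read_all_tester (R : realType) k (eps : R) : 0 <= eps ->
  round_adaptive_tester k N eps Pi (det_tester R read_all) /\
  one_sided k Pi (det_tester R read_all).
Proof.
move=> eps0.
have one : one_sided k Pi (det_tester R read_all).
  by move=> w wPi; rewrite det_accept_pr read_all_accepts wPi.
split=> //; split; first by move=> o w; apply: read_all_queries.
split=> [w /one ->|w wfar]; first by lra.
have := accept_reject_pr k (det_tester R read_all) w.
rewrite det_accept_pr read_all_accepts; case: (boolP (w \in Pi)) => [wPi|_] /=; last by lra.
case: wfar; exists w => //; rewrite /rel_dist.
by rewrite (_ : [set i | w i != w i] = set0) ?cards0 ?mul0r //; apply/setP => i; rewrite !inE eqxx.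
Qed.

End ReadAll.

(** The product [(1 - x) ^+ m * (1 + m%:R * x)] is 1 at [m = 0] and does not increase with [m]; its
    second factor is at least 3. *)
Lemma exp_onem_le (R : realType) (x : R) m :
  0 <= x <= 1 -> 2 <= m%:R * x -> (1 - x) ^+ m <= 1 / 3.
Proof.
move=> /andP[x0 x1] mx.
suff : (1 - x) ^+ m * (1 + m%:R * x) <= 1.
  have : 0 <= (1 - x) ^+ m by rewrite exprn_ge0 // subr_ge0.
  by nra.
elim: m {mx} => [|m IH]; first by rewrite mul0r addr0 mulr1.
apply: le_trans IH; rewrite exprSr -mulrA ler_wpM2l ?exprn_ge0 ?subr_ge0 //.
rewrite -natr1; have := ler0n R m; nra.
Qed.

(** * The two-round block tester *)

Section UpperBound.
Variables (F : finFieldType) (Y : finZmodType) (L d N n m : nat).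
Variables (pt : 'I_L -> F) (pos : 'I_L * bool + Y * 'I_L -> 'I_N).
Variables (e : F -> 'I_n) (ek : Y -> bool -> 'I_n) (z0 : 'I_n).
Variable dk : 'I_n -> 'I_n -> Y.
Hypotheses (pt_inj : injective pt) (pos_inj : injective pos).
Hypotheses (e_inj : injective e) (dL : (d <= L)%N).
Hypothesis ekK : forall y, dk (ek y false) (ek y true) = y.

Notation sample := {ffun 'I_m -> Y * 'I_L}.
Notation Pi := (block_prop d pt pos e ek z0).
Implicit Types (w : word N n) (o : sample) (t : option 'I_d).

(** The [d] leading columns determine a codeword, and the sampled column, at [None], tests it. *)
Definition column (j : 'I_L) t := if t is Some i then widen_ord dL i else j.

Definition probe (s : 'I_L -> Y) (c : Y * 'I_L) t : 'I_N :=
  pos (inr (c.1 + s (column c.2 t), column c.2 t)).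

Definition key_set o : {set 'I_N} :=
  [set pos (inl (column (o x.1.1).2 x.1.2, x.2)) | x : 'I_m * option 'I_d * bool].

Definition cell_set s o : {set 'I_N} :=
  [set probe s (o x.1) x.2 | x : 'I_m * option 'I_d].

(** The default [z0] makes this total on views; in a run the needed key symbols are all read in
    round 0. *)
Definition view_key (v : view N n) j : Y :=
  dk (odflt z0 (v (pos (inl (j, false))))) (odflt z0 (v (pos (inl (j, true))))).

Definition word_key w j : Y := dk (w (pos (inl (j, false)))) (w (pos (inl (j, true)))).

Definition block_strategy o : strategy N n := Strategy
  (fun h => match h with
     | [::] => pad (key_set o) (m * d.+1 * 2)
     | [:: v] => pad (cell_set (view_key v) o) (m * d.+1)
     | _ => set0
   end)
  (fun h => if h is [:: v, v' & _] then [forall i, exists u : {ffun 'I_d -> F}, forall t,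
       v' (probe (view_key v) (o i) t) == Some (e (rs pt u (column (o i).2 t)))]
     else false).

Definition consistent w (c : Y * 'I_L) := [exists u : {ffun 'I_d -> F}, forall t,
  w (probe (word_key w) c t) == e (rs pt u (column c.2 t))].

Lemma block_accepts k o w : (0 < k)%N ->
  accepts k (block_strategy o) w = [forall i, consistent w (o i)].
Proof.
case: k => // k _; rewrite /accepts.
have [h [-> _]] := history_cons2E (block_strategy o) w k.
rewrite [decide _ _]/=; set v := answers w (pad (key_set o) _).
have vE i t : view_key v (column (o i).2 t) = word_key w (column (o i).2 t).
  have ks c : pos (inl (column (o i).2 t, c)) \in pad (key_set o) (m * d.+1 * 2).
    by rewrite (subsetP (sub_pad _ _)) //; apply/imsetP; exists (i, t, c).
  by rewrite /view_key /word_key /v !ffunE /= !ks.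
apply: eq_forallb => i; apply: eq_existsb => u; apply: eq_forallb => t.
rewrite ffunE /= ifT; last first.
  by rewrite (subsetP (sub_pad _ _)) //; apply/imsetP; exists (i, t).
by rewrite /probe vE.
Qed.

Definition block_queries := (minn (m * d.+1 * 2) N + minn (m * d.+1) N)%N.

Lemma block_strategy_queries k o w : (0 < k)%N ->
  (\sum_(l < k.+1) #|round_query (block_strategy o) w l|)%N = block_queries.
Proof.
case: k => // k _; rewrite !big_ord_recl big1 => [|l _]; last first.
  rewrite /round_query !lift0; have [h [-> sh]] := history_cons2E (block_strategy o) w l.
  by rewrite /= cards0.
rewrite addn0 /round_query /= !card_pad ?card_ord //.
  by apply: leq_trans (leq_imset_card _ _) _; rewrite card_prod card_option !card_ord.
apply: leq_trans (leq_imset_card _ _) _.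
by rewrite !card_prod card_option !card_ord card_bool.
Qed.

Lemma consistent_member w c : w \in Pi -> consistent w c.
Proof.
case/imsetP => -[s g] _ -> /=; apply/existsP; exists (g c.1); apply/forallP => t.
have -> : probe (word_key (emb pos e ek z0 s (enc pt g))) c t =
    cellpos pos s c.1 (column c.2 t).
  by rewrite /probe /word_key !emb_key // ekK.
by rewrite emb_cell // ffunE.
Qed.

(* Correct the keys and the filler of [w], and complete each block from its
   first [d] columns: the result agrees with [w] on all consistent cells. *)
Lemma consistent_close w : exists2 v, v \in Pi &
  (#|[set i | w i != v i]| + #|[set c | consistent w c]| <= N)%N.
Proof.
pose s := [ffun j => word_key w j].
pose fits b (u : {ffun 'I_d -> F}) :=
  [forall i : 'I_d, w (cellpos pos s b (widen_ord dL i)) == e (rs pt u (widen_ord dL i))].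
(* A block whose leading columns fit no codeword has no consistent cell, so any message serves
   there. *)
pose g := [ffun b => odflt 0 [pick u | fits b u]].
exists (emb pos e ek z0 s (enc pt g)).
  by apply/imsetP; exists (s, g).
rewrite -(card_imset (f := fun c => cellpos pos s c.1 c.2)); last first.
  by move=> [b j] [b' j'] /pos_inj[] + jj; rewrite -jj => /addIr ->.
rewrite -[leqRHS](card_ord N) -(cardsC [set i | w i != emb pos e ek z0 s (enc pt g) i]).
rewrite leq_add2l; apply/subset_leq_card/subsetP => _ /imsetP[[b j] + ->] /=.
rewrite !inE negbK emb_cell // !ffunE /= => /existsP[u /forallP uw].
have sE j' : s j' = word_key w j' by rewrite ffunE.
have ub : fits b u.
  by apply/forallP => i; rewrite /cellpos sE; have := uw (Some i).
case: pickP => [u' /= u'b|/(_ u)]; last by rewrite ub.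
suff -> : u' = u by rewrite /cellpos sE; have := uw None.
apply: (rs_inj (J := [set widen_ord dL i | i : 'I_d]) pt_inj).
  rewrite card_imset ?card_ord // => i i' /(congr1 val) ii.
  exact: val_inj.
move=> _ /imsetP[i _ ->]; apply: e_inj.
by rewrite -(eqP (forallP u'b i)) -(eqP (forallP ub i)).
Qed.

Section Tester.
Variable R : realType.
Hypothesis L0 : (0 < L)%N.

Definition block_tester : tester R N n.
Proof.
apply: (@Tester R N n sample (fun=> #|{: sample}|%:R^-1) _ _ block_strategy).
  by move=> _; rewrite invr_ge0.
rewrite sumr_const -[LHS]mulr_natl; apply: mulfV; rewrite pnatr_eq0 -lt0n card_ffun expn_gt0.
by rewrite card_prod card_ord muln_gt0 L0 andbT; apply/orP; left; apply/card_gt0P; exists 0.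
Defined.

Lemma block_accept_pr k w : (0 < k)%N -> accept_pr k block_tester w =
  (#|[set c | consistent w c]|%:R / (#|Y| * L)%:R) ^+ m.
Proof.
move=> k0; rewrite accept_prE.
rewrite (eq_bigr (fun o : sample => #|{: sample}|%:R^-1 *
    (o \in ffun_on [set c | consistent w c])%:R)) => [|o _]; last first.
  congr (_ * _%:R); rewrite block_accepts //; congr nat_of_bool.
  by apply/forallP/ffun_onP => oc i; have := oc i; rewrite inE.
rewrite -mulr_sumr -natr_sum -big_mkcond sum1_card card_ffun_on.
by rewrite card_ord natrX card_ffun card_prod !card_ord natrX expr_div_n mulrC.
Qed.

(** A far word differs from every member in at least [eps * N] coordinates, so at most a fraction
    [1 - eps / 2] of the cells is consistent. As [m * eps / 2] is at least 2, the [m] samples miss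
    the others with probability at most 1/3. *)
Lemma block_tester_correct k (eps : R) : (0 < k)%N -> 0 <= eps <= 1 ->
  (1 - eps) * N%:R <= (1 - eps / 2) * (#|Y| * L)%:R -> 4 <= m%:R * eps ->
  round_adaptive_tester k block_queries eps Pi block_tester /\
  one_sided k Pi block_tester.
Proof.
move=> k0 /andP[eps0 eps1] NYL m4.
have YL0 : 0 < (#|Y| * L)%:R :> R.
  by rewrite ltr0n muln_gt0 L0 andbT; apply/card_gt0P; exists 0.
have one : one_sided k Pi block_tester.
  move=> w wPi; rewrite block_accept_pr // (_ : [set c | consistent w c] = setT).
    by rewrite cardsT card_prod card_ord divff ?expr1n // gt_eqF.
  by apply/setP => c; rewrite !inE consistent_member.
split=> //; split; first by move=> o w; apply: block_strategy_queries.
split=> [w /one ->|w wfar]; first by lra.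
suff : accept_pr k block_tester w <= 1 / 3.
  by have := accept_reject_pr k block_tester w; lra.
rewrite block_accept_pr //.
have [v vPi diff] := consistent_close w.
have dist : eps * N%:R <= #|[set i | w i != v i]|%:R.
  rewrite leNgt; apply/negP => close; apply: wfar; exists v => //.
  have [N0|N0] := posnP N; last by rewrite /rel_dist ler_pdivrMr ?ltr0n // ltW.
  have NR : N%:R = 0 :> R by rewrite N0.
  by rewrite /rel_dist NR invr0 mulr0.
apply: le_trans (exp_onem_le (x := eps / 2) (m := m) _ _); last 2 first.
- by lra.
- by lra.
apply: lerXn2r; rewrite ?nnegrE ?divr_ge0 //; first by lra.
rewrite ler_pdivrMr //; move: diff; rewrite -(ler_nat R) natrD; lra.
Qed.

End Tester.
End UpperBound.

(** * Choice of the parameters *)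

Lemma far_const (R : realType) N n (Pi : {set word N n}) (a : 'I_n) (eps : R) :
  (0 < N)%N -> eps < 1 -> (forall v i, v \in Pi -> v i != a) ->
  far eps ([ffun=> a] : word N n) Pi.
Proof.
move=> N0 eps1 Pia [v vPi]; rewrite /rel_dist.
rewrite (_ : [set i | _] = setT); last first.
  by apply/setP => i; rewrite !inE ffunE eq_sym Pia.
by rewrite cardsT card_ord divff ?pnatr_eq0 -?lt0n // leNgt eps1.
Qed.

(* Members never use the symbol [ord_max], so its constant word is at relative
   distance 1 from the property; it excludes testers without queries when n is
   too small for the counting bound. *)
Lemma hidden_blocks (R : realType) N n k phi L B d r :
  (0 < phi)%N -> (2 ^ phi <= n)%N -> (0 < L <= 2 ^ phi)%N -> (B.+1 <= n ^ 2)%N ->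
  ((B.+1 + 2) * L <= N)%N -> (d <= L)%N -> (k + r <= d.+1)%N ->
  exists Pi : {set word N n.+1},
  [/\ exists v w, v \in Pi /\ forall eps : R, eps < 1 -> far eps w Pi,
    forall (m : nat) (eps : R), (0 < k)%N -> 0 <= eps <= 1 ->
      (1 - eps) * N%:R <= (1 - eps / 2) * (B.+1 * L)%:R -> 4 <= m%:R * eps ->
      exists T : tester R N n.+1,
        round_adaptive_tester k (block_queries d N m) eps Pi T /\ one_sided k Pi T
  & forall (T : tester R N n.+1) q (eps delta : R), 0 <= delta ->
      tail_adaptive_tester k q eps delta Pi T ->
      1 - 2 * delta <= (B.+1 * q ^ r)%:R / (B.+1 ^ r)%:R +
        (B.+1 ^ L * 2 ^ (phi * (d * B.+1)) *
        (2 ^ (B.+1 * L) * 2 ^ (phi * Num.truncn (eps * N%:R))))%:R /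
        (2 ^ (phi * (B.+1 * L)))%:R].
Proof.
move=> phi0 fn /andP[L0 Lf] Bn BLN dL krd.
have [F _ cardF] := pPrimePowerField (isT : prime 2) phi0.
have n0 : (0 < n)%N by apply: leq_trans fn; rewrite expn_gt0.
have N0 : (0 < N)%N by apply: leq_trans BLN; rewrite muln_gt0.
pose pt (j : 'I_L) : F := enum_val (cast_ord (esym cardF) (widen_ord Lf j)).
have pt_inj : injective pt.
  by move=> j j' /enum_val_inj/cast_ord_inj/(congr1 val) /= jj; apply: val_inj.
have cardT : (#|{: 'I_L * bool + 'I_B.+1 * 'I_L}| <= N)%N.
  by rewrite card_sum !card_prod !card_ord card_bool; lia.
pose pos t := widen_ord cardT (enum_rank t).
have pos_inj : injective pos.
  by move=> t t' /(congr1 val) /= tt; apply: enum_rank_inj; apply: val_inj.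
pose e (x : F) : 'I_n.+1 := inord (enum_rank x).
have rank_lt (x : F) : (enum_rank x < n)%N by apply: leq_trans fn; rewrite -cardF.
have eE x : e x = enum_rank x :> nat by rewrite inordK // ltnW // ltnS.
have e_inj : injective e.
  by move=> x x' /(congr1 val); rewrite /= !eE => xx; apply: enum_rank_inj; apply: val_inj.
(* Keys are below [n ^ 2] and are written as two base-[n] digits, which like the ranks above avoid
   the last symbol. *)
pose ek (y : 'I_B.+1) (c : bool) : 'I_n.+1 := inord (if c then y %/ n else y %% n)%N.
have ek_lt (y : 'I_B.+1) (c : bool) : ((if c then y %/ n else y %% n) < n)%N.
  case: c; last by rewrite ltn_mod.
  by rewrite ltn_divLR //; apply: leq_trans (ltn_ord y) _; rewrite mulnn.
have ekE y c : ek y c = (if c then y %/ n else y %% n)%N :> nat.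
  by rewrite inordK // ltnW // ltnS.
pose dk (u v : 'I_n.+1) : 'I_B.+1 := inord (v * n + u).
have ekK y : dk (ek y false) (ek y true) = y.
  by rewrite /dk !ekE -divn_eq inord_val.
exists (block_prop d pt pos e ek ord0); split.
- pose g0 : {ffun 'I_B.+1 -> {ffun 'I_d -> F}} := [ffun=> [ffun=> 0]].
  exists (emb pos e ek ord0 [ffun=> 0] (enc pt g0)), [ffun=> ord_max]; split.
    by apply/imsetP; exists ([ffun=> 0], g0).
  move=> eps eps1; apply: far_const => // _ i /imsetP[[s g] _ ->].
  rewrite ffunE; case: pickP => [[[j c]|z]|] _; apply/eqP => /(congr1 val) /=.
  + by apply/eqP; rewrite ekE neq_ltn ek_lt.
  + by apply/eqP; rewrite eE neq_ltn rank_lt.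
  + by move=> n0'; rewrite -n0' in n0.
- move=> m eps k0 eps01 NBL m4.
  exists (block_tester m pt pos e ord0 dk dL R L0).
  by apply: block_tester_correct => //; rewrite card_ord.
- move=> T q eps delta delta0 tail.
  have := tail_adaptive_bound pt_inj pos_inj e_inj dL krd delta0 tail.
  by rewrite cardF card_ord -!expnM.
Qed.

(** All sizes are measured in powers of [a], so that later estimates involve natural exponents only:
    [a ^+ 4] is [n] to the power [alpha], and the exponent [(Num.truncn (4 / alpha)).+1] is large
    enough to reach [n]. *)
Lemma wlen_bounds (R : realType) (alpha : R) (n : nat) (a := n%:R `^ (alpha / 4)) :
  0 < alpha < 1 -> (0 < n)%N ->
  [/\ 1 <= a, a ^+ 4 <= n%:R, n%:R <= a ^+ (Num.truncn (4 / alpha)).+1 &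
      n%:R * a ^+ 4 - 1 / 2 <= (wlen alpha n)%:R <= n%:R * a ^+ 4 + 1 / 2].
Proof.
move=> /andP[al0 al1] n0; have n1 : 1 <= n%:R :> R by rewrite ler1n.
have a1 : 1 <= a by rewrite -(powRr0 n%:R) ler_powR // divr_ge0 // ltW.
have a4 : a ^+ 4 = n%:R `^ alpha.
  by rewrite -powR_mulrn ?powR_ge0 // -powRrM divfK ?pnatr_eq0.
split=> //.
- rewrite a4 -[leRHS]powRr1 // ler_powR //. by rewrite ltW.
- rewrite -powR_mulrn ?powR_ge0 // -powRrM -[leLHS]powRr1 // ler_powR //.
  by have := truncnS_gt (4 / alpha); rewrite ltr_pdivrMr //; lra.
- have E : n%:R * a ^+ 4 = n%:R `^ (1 + alpha).
    by rewrite a4 powRD ?powRr1 //; apply/implyP => _; rewrite gt_eqF // ltr0n.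
  have h0 : 0 <= n%:R `^ (1 + alpha) + 2^-1 by rewrite addr_ge0 ?powR_ge0 ?invr_ge0.
  have /andP[] := truncn_itv h0.
  rewrite -/(wlen alpha n) E -[(wlen alpha n).+1%:R]natr1; lra.
Qed.

Lemma a4_ge (R : realType) (a : R) : 100 <= a -> 100 * a <= a ^+ 4.
Proof.
move=> a_ge; have a2 : 100 * a <= a ^+ 2 by rewrite expr2; nra.
have -> : a ^+ 4 = a ^+ 2 * a ^+ 2 by rewrite -exprD.
by nra.
Qed.

Lemma parameters (R : realType) (a : R) (n N : nat) :
  100 <= a -> a ^+ 4 <= n%:R ->
  n%:R * a ^+ 4 - 1 / 2 <= N%:R <= n%:R * a ^+ 4 + 1 / 2 ->
  exists phi L B : nat,
  [/\ (0 < phi)%N, (2 ^ phi <= n.-1 < 2 ^ phi.+1)%N, (0 < L <= 2 ^ phi)%N,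
      (B.+1 <= n.-1 ^ 2)%N /\ ((B.+1 + 2) * L <= N < (B.+1 + 3) * L)%N &
      L%:R <= a ^+ 2 < L.+1%:R].
Proof.
move=> a_ge an N_bounds; have a4 := a4_ge a_ge.
have n_big : (100 <= n)%N by rewrite -(ler_nat R); lra.
pose L := Num.truncn (a ^+ 2); pose phi := trunc_log 2 n.-1.
have a2 : 100 * a <= a ^+ 2 by rewrite expr2; nra.
have La : L%:R <= a ^+ 2 < L.+1%:R by apply: truncn_itv; rewrite exprn_ge0 //; lra.
have L9 : (9 <= L)%N by rewrite -ltnS -(ltr_nat R); lra.
have phin : (2 ^ phi <= n.-1 < 2 ^ phi.+1)%N by apply: trunc_log_bounds => //; lia.
have a42 : a ^+ 4 = a ^+ 2 * a ^+ 2 by rewrite -exprD.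
have Ln : (L * L <= n)%N.
  rewrite -(ler_nat R) natrM (le_trans _ an) // a42.
  by apply: ler_pM => //; case/andP: La.
have LN : (N <= n * n)%N.
  rewrite -ltnS -(ltr_nat R) -natr1 natrM.
  have : n%:R * a ^+ 4 <= n%:R * n%:R by rewrite ler_wpM2l.
  by lra.
have NL : (9 * L <= N)%N.
  rewrite -(ler_nat R) natrM.
  have : a ^+ 2 * 100 <= n%:R * a ^+ 4.
    rewrite a42 mulrCA ler_wpM2l //; first by lra.
    have : 1 <= n%:R :> R by rewrite ler1n; lia.
    by nra.
  by lra.
(* Of the [N %/ L] rows that fit, two hold the keys and the remaining [B.+1] hold the cells. *)
exists phi, L, (N %/ L - 3)%N.
have L0 : (0 < L)%N by apply: leq_trans L9.
have NL9 : (9 <= N %/ L)%N by rewrite leq_divRL.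
have eq1 : ((N %/ L - 3).+1 + 2 = N %/ L)%N by clear -NL9; lia.
have eq2 : ((N %/ L - 3).+1 + 3 = (N %/ L).+1)%N by clear -NL9; lia.
split=> //.
- by rewrite /phi trunc_log_gt0; clear -n_big; lia.
- apply/andP; split=> //.
  have [_ +] := andP phin; rewrite expnS; move: (2 ^ phi)%N => f nf.
  clear -nf L9 Ln; nia.
- rewrite eq1 eq2; split; last by rewrite leq_divM ltn_ceil.
  have := leq_divM N L; clear -L9 LN n_big; nia.
Qed.

(** * Numerical estimates, with [B] the number of blocks *)

Section Estimates.
Variables (R : realType) (a : R) (n N phi L B : nat).
Hypotheses (a_ge : 100 <= a) (an : a ^+ 4 <= n%:R).
Hypothesis N_ge : n%:R * a ^+ 4 - 1 / 2 <= N%:R.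
Hypotheses (La : L%:R <= a ^+ 2 < L.+1%:R) (BL_le : ((B + 2) * L <= N)%N).
Hypothesis N_lt : (N < (B + 3) * L)%N.
Hypothesis Bn : (B <= n ^ 2)%N.

Lemma cells_ge : N%:R - 3 * a ^+ 2 <= (B * L)%:R :> R.
Proof.
have := N_lt; rewrite -(ltr_nat R) natrM natrD natrM mulrDl.
by have := La; lra.
Qed.

Lemma length_ge : a ^+ 4 <= N%:R.
Proof.
have := N_ge; have := a4_ge a_ge; have := an; have := a_ge.
by move: (n%:R) (a ^+ 4) => x y; nra.
Qed.

(** The at most [3 * a ^+ 2] coordinates that are not cells amount to at most half of [eps * N], as
    [N] is at least [a ^+ 4]. *)
Lemma testable_size (eps : R) : 0 < eps <= 1 -> 6 <= a * eps ->
  (1 - eps) * N%:R <= (1 - eps / 2) * (B * L)%:R.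
Proof.
move=> eps01 aeps; have := cells_ge; have := length_ge; have := a_ge.
have -> : a ^+ 4 = a ^+ 2 * a ^+ 2 by rewrite -exprD.
have a2 : a <= a ^+ 2 by rewrite expr2; have := a_ge; nra.
move: (N%:R) (B * L)%N%:R => x y h1 h2 h3.
have h4 : 6 * a ^+ 2 <= eps * x by nra.
by nra.
Qed.

(** [B] is close to [N / L], thus to [n * a ^+ 2]; one factor [a] absorbs the rounding. *)
Lemma rows_ge : n%:R * a <= B%:R.
Proof.
have := N_lt; rewrite -(ltr_nat R) natrM natrD => NB.
have {NB} : n%:R * a ^+ 4 - 1 / 2 < (B%:R + 3) * a ^+ 2.
  apply: le_lt_trans N_ge (lt_le_trans NB _).
  by rewrite ler_wpM2l ?addr_ge0 //; case/andP: La.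
have -> : a ^+ 4 = a ^+ 2 * a ^+ 2 by rewrite -exprD.
have a2 : 100 * a <= a ^+ 2 by rewrite expr2; have := a_ge; nra.
have := a4_ge a_ge; have := an; have := a_ge; move: (a ^+ 4) => a4.
move: a2 (n%:R) (B%:R) => a2 x y h1 h2 h3 h4.
have h5 : x * a ^+ 2 - 1 / 2 < y + 3.
  rewrite -(ltr_pM2r (_ : 0 < a ^+ 2)); last by lra.
  apply: le_lt_trans h4; rewrite mulrBl mulrA lerD2l lerN2; nra.
have h6 : x * (100 * a) <= x * a ^+ 2 by rewrite ler_wpM2l //; lra.
by nra.
Qed.

(** Each of the [2 r + 1] factors [q / B] is at most [1 / a], and [B <= n ^ 2 <= a ^ (2 r)]: all
    factors but one pay for the leading [B]. *)
Lemma crowded_estimate q r : (q <= n)%N -> n%:R <= a ^+ r ->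
  (B * q ^ (r * 2).+1)%:R / (B ^ (r * 2).+1)%:R <= a^-1.
Proof.
move=> qn nr; have := rows_ge; have := a_ge => a1 rows.
have a0 : 0 < a by lra.
have n0 : 0 < n%:R :> R by have := an; have := a4_ge a_ge; lra.
have B0 : 0 < B%:R :> R by apply: lt_le_trans rows; rewrite mulr_gt0.
have Bnn : B%:R <= n%:R * n%:R :> R by rewrite -natrM ler_nat mulnn.
rewrite natrM !natrX -mulrA -expr_div_n.
have qB : q%:R / B%:R <= a^-1.
  rewrite ler_pdivrMr // mulrC ler_pdivlMr //.
  by apply: le_trans rows; rewrite ler_pM2r // ler_nat.
have qB' : (q%:R / B%:R) ^+ (r * 2).+1 <= a^-1 ^+ (r * 2).+1.
  by rewrite lerXn2r // nnegrE ?divr_ge0 ?invr_ge0 // ltW.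
apply: le_trans (ler_wpM2l (ltW B0) qB') _.
rewrite exprSr mulrA; apply: ler_piMl; first by rewrite invr_ge0 ltW.
rewrite exprVn ler_pdivrMr ?exprn_gt0 // mul1r (le_trans Bnn) //.
by rewrite exprM expr2 ler_pM //; apply: ltW.
Qed.

Hypotheses (phi0 : (0 < phi)%N) (n_phi : (n <= 2 ^ phi.+1)%N).

(** Compare exponents of 2. [B ^ L] contributes at most [4 * phi * L]; both [L] and [d * B] are
    [O(N / a)], and [m <= eps * N]. The denominator therefore wins by at least [N] bits. *)
Lemma near_estimate d m (eps : R) : (d%:R <= 2 * a) -> m%:R <= eps * N%:R ->
  22 <= a * (1 - eps) -> 4 <= phi%:R * (1 - eps) ->
  (B ^ L * 2 ^ (phi * (d * B)) * (2 ^ (B * L) * 2 ^ (phi * m)))%:R /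
    (2 ^ (phi * (B * L)))%:R <= a^-1.
Proof.
move=> da mN aeps phieps.
have a1 := a_ge; have Nge := length_ge; have cells := cells_ge.
have a3 : a * a ^+ 3 = a ^+ 4 by rewrite -exprS.
have a2 : 100 * a <= a ^+ 2 by rewrite expr2; nra.
have a0 : 0 < a by lra.
have [L_le _] := andP La.
have eps1 : 0 < 1 - eps by nra.
have L7 : 7 * L%:R * a <= 7 * N%:R.
  have : a ^+ 2 * a <= a ^+ 4 by rewrite -exprSr; nra.
  by nra.
have NR : (B * L)%:R <= N%:R :> R.
  by rewrite ler_nat (leq_trans _ BL_le) // leq_mul2r leq_addr orbT.
have dB : (d * B)%:R * a <= 4 * N%:R.
  have L2 : a ^+ 2 <= 2 * L%:R.
    by have := La; rewrite -natr1; lra.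
  move: NR; rewrite !natrM => NR.
  have h1 : d%:R * B%:R * a <= 2 * a * B%:R * a by rewrite !ler_wpM2r // ltW.
  have h2 : B%:R * a ^+ 2 <= B%:R * (2 * L%:R) by rewrite ler_wpM2l.
  by move: h1 h2; rewrite expr2; lra.
have main : (phi * (4 * L + d * B + m) + B * L + N <= phi * (B * L))%N.
  (* After multiplication by [a] the losses are [7 * L * a <= 7 * N] and [d * B * a <= 4 * N]; twice
     their sum gives the 22 of the hypothesis. *)
  have gap : (1 - eps) * N%:R <= 2 * ((B * L)%:R - 4 * L%:R - (d * B)%:R - m%:R).
    rewrite -(ler_pM2r a0).
    have : 22 * N%:R <= a * (1 - eps) * N%:R by rewrite ler_wpM2r.
    have := N_lt; rewrite -(ltr_nat R) mulnDl natrD => N3.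
    have N3a := ler_wpM2r (ltW a0) (ltW N3).
    have mNa := ler_wpM2r (ltW a0) mN.
    rewrite [(3 * L)%:R]natrM in N3a.
    move: L7 dB N3a mNa.
    move: (d * B)%N%:R (B * L)%N%:R L%:R N%:R m%:R => x y l z t; lra.
  have two : 4 * N%:R <= phi%:R * (1 - eps) * N%:R by rewrite ler_wpM2r.
  have phi_gap := ler_wpM2l (ler0n R phi) gap.
  rewrite -(ler_nat R) natrD natrD natrM natrD natrD (natrM _ 4) (natrM _ phi).
  by move: two phi_gap NR; lra.
rewrite ler_pdivrMr ?ltr0n ?expn_gt0 // mulrC ler_pdivlMr //.
(* The spare [N] bits yield the factor [a^-1], since [a <= N <= 2 ^ N]. *)
apply: (@le_trans _ _ ((B ^ L * 2 ^ (phi * (d * B)) * (2 ^ (B * L) * 2 ^ (phi * m))) * 2 ^ N)%:R).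
  rewrite [leRHS]natrM ler_wpM2l // (@le_trans _ _ N%:R) //.
    by apply: le_trans Nge; have := a4_ge a_ge; lra.
  by rewrite ler_nat ltnW // ltn_expl.
rewrite ler_nat -mulnA -mulnA -!expnD.
apply: (@leq_trans (2 ^ (phi * 4 * L) * 2 ^ (phi * (d * B) + (B * L + phi * m + N)))).
  rewrite leq_mul2r; apply/orP; right; rewrite expnM.
  have [->|L0] := posnP L; first by rewrite !expn0.
  rewrite leq_exp2r //.
  apply: leq_trans Bn _; apply: (@leq_trans ((2 ^ phi.+1) ^ 2)).
    by rewrite leq_exp2r.
  by rewrite -expnM leq_exp2l //; clear -phi0; lia.
rewrite -expnD leq_exp2l //; apply: leq_trans main; clear; nia.
Qed.

End Estimates.

(** * Assembly of the theorem *)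

Lemma truncn_div_ge (R : realType) (x y : R) :
  0 < y -> x <= (Num.truncn (x / y)).+1%:R * y.
Proof. by move=> y0; rewrite -ler_pdivrMr // ltW // truncnS_gt. Qed.

Lemma block_queries_le k r N m : (0 < k)%N ->
  (block_queries (k + r) N m <= 3 * m * (r + 2) * k)%N.
Proof.
move=> k0; apply: (@leq_trans (m * (k + r).+1 * 2 + m * (k + r).+1)).
  by rewrite leq_add // geq_minl.
have : (m * (k + r).+1 <= m * ((r + 2) * k))%N by rewrite leq_mul2l; apply/orP; right; nia.
by rewrite mulnA; lia.
Qed.

Lemma invr_lt_half (R : realType) (x a : R) : 0 < x -> 4 / x < a -> a^-1 < x / 2.
Proof.
move=> x0; rewrite ltr_pdivrMr // => xa.
have a0 : 0 < a by rewrite -(pmulr_lgt0 _ x0); lra.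
by rewrite -[a^-1]mul1r ltr_pdivrMr //; lra.
Qed.

Theorem theorem6p7 (R : realType) (alpha : R) :
  0 < alpha < 1 ->
  exists2 beta : R, 0 < beta < 1 &
  exists (C : R -> R) (a : R -> nat) (c : R -> R -> R),
    (forall eps delta : R, 0 < c eps delta) /\
    forall n k : nat, k%:R <= n%:R `^ beta ->
    exists Pi : {set word (wlen alpha n) n},
    forall eps : R, 0 < eps <= 1 ->
      (exists (q : nat) (T : tester R (wlen alpha n) n),
         [/\ round_adaptive_tester k q eps Pi T,
             one_sided k Pi T
           & (0 < k)%N -> q%:R <= C eps * k%:R * (1 + ln k%:R) ^+ a eps]) /\
      (eps < 1 ->
       forall delta : R, 0 < delta < 1 / 2 ->
       (1 < n)%N ->
       forall (q : nat) (T : tester R (wlen alpha n) n),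
         tail_adaptive_tester k q eps delta Pi T ->
         c eps delta * n%:R <= q%:R).
Proof.
move=> al; have /andP[al0 al1] := al.
(* With [a] equal to [n] to the power [alpha / 4], [n <= a ^+ s]; [r] is the matching exponent of
   [crowded_estimate]. *)
pose s := (Num.truncn (4 / alpha)).+1; pose r := (s * 2).+1.
pose A0 : R := 100 + r%:R.
pose reps (eps : R) := (Num.truncn (4 / eps)).+1.
(* Above [A1] the block tester applies; up to it the word has bounded length, and the last terms of
   [C] pay for reading it all. *)
pose A1 (eps : R) := A0 + 6 / eps.
pose C eps := (3 * reps eps * (r + 2))%:R + A1 eps ^+ (s + 4) + 1.
pose h (eps : R) := (Num.truncn (4 / (1 - eps))).+1.
(* The terms after [A0] give, in order, [22 <= a * (1 - eps)], [4 <= phi * (1 - eps)] and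
   [a^-1 < (1 - 2 * delta) / 2]. *)
pose A2 (eps delta : R) := A0 + 22 / (1 - eps) + (2 ^ h eps)%:R + 4 / (1 - 2 * delta).
(* If [a] is at most [A2], then [n <= a ^+ s] gives [c * n <= 1], so that one query meets the bound.
   The absolute value keeps [c] positive for all arguments. *)
pose c eps delta := (1 + `|A2 eps delta| ^+ s)^-1.
have c_bounds eps delta : 0 < c eps delta <= 1.
  have A2_ge0 : 0 <= `|A2 eps delta| ^+ s by rewrite exprn_ge0.
  rewrite /c invr_gt0 invf_le1; last by lra.
  by lra.
(* This makes [k <= a], while the number [L] of columns is about [a ^+ 2]. The logarithmic exponent
   chosen next is 0: the tester is linear in [k]. *)
exists (alpha / 4); first by lra.
exists C, (fun=> 0%N), c; split=> [eps delta|n k kn].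
  by have /andP[] := c_bounds eps delta.
set N := wlen alpha n; pose a : R := n%:R `^ (alpha / 4).
have A0_ge : 100 <= A0 by rewrite lerDl.
have A1_ge eps : 0 < eps -> A0 <= A1 eps.
  by move=> eps0; rewrite lerDl divr_ge0 // ltW.
have n_pos : (0 < k)%N -> (0 < n)%N.
  move=> k0; rewrite lt0n; apply: contraTneq kn => ->.
  by rewrite powR0 ?gt_eqF ?divr_gt0 // -ltNge ltr0n.
have read_few eps : 0 < eps -> (0 < k)%N -> a <= A1 eps ->
    N%:R <= C eps * k%:R * (1 + ln k%:R) ^+ 0.
  move=> eps0 k0 aA1.
  have [a1 a4 ns /andP[_ Nn]] := wlen_bounds al (n_pos k0).
  have a_ge0 : 0 <= a by apply: powR_ge0.
  have aX : n%:R * a ^+ 4 <= A1 eps ^+ (s + 4).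
    rewrite exprD ler_pM ?exprn_ge0 //.
      by apply: le_trans ns _; rewrite lerXn2r ?nnegrE // (le_trans a_ge0).
    by rewrite lerXn2r ?nnegrE // (le_trans a_ge0).
  have k1 : 1 <= k%:R :> R by rewrite ler1n.
  have C0 : N%:R <= C eps.
    rewrite (le_trans Nn) // /C; have := ler0n R (3 * reps eps * (r + 2)).
    by move: aX; rewrite -/a; lra.
  rewrite expr0 mulr1 (le_trans C0) // ler_peMr // (le_trans _ C0) //.
have few_symbols eps delta q : (1 < n)%N -> a <= A2 eps delta -> (0 < q)%N ->
    c eps delta * n%:R <= q%:R.
  move=> n1 aA2 q0; have [a1 _ ns _] := wlen_bounds al (ltnW n1).
  apply: (@le_trans _ _ 1); last by rewrite ler1n.
  rewrite /c mulrC ler_pdivrMr ?mul1r; last first.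
    by rewrite ltr_pwDl ?exprn_ge0.
  apply: le_trans ns _; rewrite ler_wpDl // lerXn2r ?nnegrE ?powR_ge0 //.
  exact: le_trans aA2 (ler_norm _).
have A2_ge eps delta : eps < 1 -> delta < 1 / 2 ->
    [/\ A0 <= A2 eps delta, 22 / (1 - eps) <= A2 eps delta,
        (2 ^ h eps)%:R <= A2 eps delta & 4 / (1 - 2 * delta) <= A2 eps delta].
  move=> eps1 delta2.
  have t1 : 0 <= 22 / (1 - eps) by rewrite divr_ge0 //; lra.
  have t2 : 0 <= 4 / (1 - 2 * delta) by rewrite divr_ge0 //; lra.
  have t3 := ler0n R (2 ^ h eps).
  by rewrite /A2; split; lra.
have [/andP[n0 aA0]|small] := boolP ((0 < n)%N && (A0 <= a)); last first.
  (* For bounded [n] the property of being constantly 0 is enough: reading everything tests it, and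
     the constant word 1 forces a query. *)
  exists [set w : word N n | [forall i, w i == 0 :> nat]] => eps /andP[eps0 eps1].
  set Pi := finset _; split.
    have [T1 T2] := read_all_tester Pi k (ltW eps0).
    exists N, (det_tester R (read_all Pi)); split=> // k0.
    apply: read_few => //; rewrite (le_trans _ (A1_ge _ eps0)) //.
    by move: small; rewrite (n_pos k0) /= -ltNge => /ltW.
  move=> {}eps1 delta /andP[delta0 delta2] n1 q T tail.
  have [a1 a4 ns /andP[Nn _]] := wlen_bounds al (ltnW n1).
  have [A0A2 _ _ _] := A2_ge eps delta eps1 delta2.
  apply: few_symbols => //.
    apply: le_trans A0A2.
    by move: small; rewrite (ltnW n1) /= -ltNge => /ltW.
  have N0 : (0 < N)%N.
    rewrite -(ltr_nat R) (lt_le_trans _ Nn) // -/a.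
    have n2 : 2 <= n%:R :> R by rewrite ler_nat.
    have : n%:R * 1 <= n%:R * a ^+ 4 by rewrite ler_wpM2l // exprn_ege1.
    by move: n2; lra.
  pose v : word N n := [ffun=> Ordinal (ltnW n1)].
  have vPi : v \in Pi by rewrite inE; apply/forallP => i; rewrite ffunE.
  apply: (tail_adaptive_query_gt0 delta2 vPi _ tail (w := [ffun=> Ordinal n1])).
  apply: far_const => // w i; rewrite inE => /forallP/(_ i)/eqP wi.
  by apply/eqP => /(congr1 val); rewrite /= wi.
case: n => // n in kn N a n_pos read_few few_symbols n0 aA0 *.
have [_ an ns Nn] := wlen_bounds al n0.
rewrite -/a -/N -/s in an ns Nn.
have a100 : 100 <= a by lra.
have [phi [L [B [phi0 /andP[fn nf] Lf [Bn /andP[BL_le N_lt]] La]]]] := parameters a100 an Nn.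
have /andP[N_ge _] := Nn.
have Bn' : (B.+1 <= n.+1 ^ 2)%N by rewrite (leq_trans Bn) // leq_sqr.
have da : (k + r)%:R <= 2 * a by move: kn aA0; rewrite -/a natrD /A0; lra.
have dL : (k + r <= L)%N.
  rewrite -ltnS -(ltr_nat R); case/andP: La => _; apply: le_lt_trans.
  by rewrite (le_trans da) // expr2; nra.
have [Pi [[v [w [vPi wfar]]] upper lower]] :=
  hidden_blocks R phi0 fn Lf Bn BL_le dL (leqnSn (k + r)).
exists Pi => eps /andP[eps0 eps1]; split.
  have [aA1|A1a] := lerP a (A1 eps).
    have [T1 T2] := read_all_tester Pi k (ltW eps0).
    by exists N, (det_tester R (read_all Pi)); split=> // k0; apply: read_few.
  have [k0|k0] := posnP k.
    have [T1 T2] := read_all_tester Pi k (ltW eps0).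
    by exists N, (det_tester R (read_all Pi)); split=> //; rewrite k0.
  have [|||T [T1 T2]] := upper (reps eps) eps k0.
  - by lra.
  - apply: (testable_size a100 an N_ge La N_lt); first by lra.
    have : 6 / eps <= a by rewrite /A1 in A1a; lra.
    by rewrite ler_pdivrMr.
  - exact: truncn_div_ge.
  exists (block_queries (k + r) N (reps eps)), T; split=> // _.
  rewrite expr0 mulr1.
  have A1_pos : 0 <= A1 eps ^+ (s + 4).
    by rewrite exprn_ge0 // (le_trans _ (A1_ge _ eps0)) //; lra.
  apply: (@le_trans _ _ (3 * reps eps * (r + 2) * k)%:R); first by rewrite ler_nat block_queries_le.
  by rewrite natrM ler_wpM2r // /C; lra.
move=> {}eps1 delta /andP[delta0 delta2] n1 q T tail.
have q0 := tail_adaptive_query_gt0 delta2 vPi (wfar _ eps1) tail.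
have [aA2|A2a] := lerP a (A2 eps delta); first exact: few_symbols.
have [A0A2 epsA2 hA2 deltaA2] := A2_ge eps delta eps1 delta2.
have /andP[c0 c1] := c_bounds eps delta.
have [nq|qn] := leqP n.+1 q.
  by rewrite (@le_trans _ _ n.+1%:R) ?ler_nat // ler_piMl.
(* With fewer queries than symbols, both error terms are at most [a^-1], hence each is below half of
   [1 - 2 * delta]. *)
exfalso; have low := lower T q eps delta (ltW delta0) tail.
have e1 := crowded_estimate a100 an N_ge La N_lt Bn' (ltnW qn) ns.
have hphi : (h eps <= phi)%N.
  rewrite -ltnS -(ltn_exp2l (m := 2)) // (leq_ltn_trans _ nf) //= -ltnS.
  rewrite -(ltr_nat R); have := a4_ge a100; clear -hA2 A2a an a100; lra.
have e2 : (B.+1 ^ L * 2 ^ (phi * ((k + r) * B.+1)) *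
    (2 ^ (B.+1 * L) * 2 ^ (phi * Num.truncn (eps * N%:R))))%:R /
    (2 ^ (phi * (B.+1 * L)))%:R <= a^-1.
  apply: (near_estimate a100 an N_ge La BL_le N_lt Bn' phi0 nf (eps := eps)) => //.
  - by rewrite truncn_le mulr_ge0 // ltW.
  - by rewrite -ler_pdivrMr ?(le_trans epsA2) ?subr_gt0 // ltW.
  - apply: le_trans (truncn_div_ge 4 (_ : 0 < 1 - eps)) _; first by rewrite subr_gt0.
    by rewrite ler_wpM2r ?ler_nat // subr_ge0 ltW.
have a_inv : a^-1 < (1 - 2 * delta) / 2.
  apply: invr_lt_half (le_lt_trans deltaA2 A2a); clear -delta2; lra.
by move: (le_trans low (lerD e1 e2)) a_inv; clear; lra.
Qed.
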